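(* Let $K=(K_{pq})_{p,q\in S}$ be an irreducible, aperiodic stochastic matrix on a finite set $S$ with stationary distribution $\mu$, let $f\in\mathbb{R}^S$, let $h\in\mathbb{R}^S$ be the solution of $(I-K)h=f-(f^T\mu)\mathbf{1}$, $h^T\mu=0$, and let $\mathcal{B}$ be a partition of $S$. Let $\lambda(u)>0$, $u\in\mathcal{B}$, be such that $\sum_{u\in \mathcal{B}}\lambda(u) = 1$. For each $u \in \mathcal{B}$, let $\nu(u) = (\nu(u)_p)_{p \in S}$ be a vector satisfying $\nu(u)_p \ge 0$ for $p \in S$, $\nu(u)_p = 0$ for $p \notin u$, and $\sum_{p \in u}\nu(u)_p = 1$. Let $A(u)$ be the random matrix that takes the value $e_p e_q^T- e_pe_p^T K$ with probability $\nu(u)_pK_{pq}$, for $p \in u$, $q \in S$ (that is, $A(u)=e_Pe_Q^T-e_Pe_P^TK$ where $\mathbb{P}(P=p,Q=q)=\nu(u)_pK_{pq}$). Let $A(u)^{(n)}$, for $u \in \mathcal{B}$ and $n = 1,2,\ldots$, be independent copies of $A(u)$ (independent over all $u$ and $n$), and for $N$ large enough that $\lfloor N\lambda(u)\rfloor\ge1$ for all $u$ define $$B^{(N)} = \sqrt{N}\sum_{u \in \mathcal{B}} \frac{1}{\lfloor N \lambda(u)\rfloor}\sum_{n=1}^{\lfloor N\lambda(u)\rfloor} A(u)^{(n)}.$$ Then $$\lim_{N \to \infty} \mathbb{E}\left[\left(\left.\frac{d}{d\epsilon}\mu(K+\epsilon B^{(N)})^T\right|_{\epsilon = 0}f \right)^2\right]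 = \sum_{u \in \mathcal{B}}\lambda(u)^{-1}\sum_{p \in u} \nu(u)_p\mu_p^2\left[(Kh^2)_p - (Kh)_p^2\right].$$
   Context: Vectors indexed by $S$ are column vectors; $e_p$ is the vector with $1$ in entry $p$ and $0$ elsewhere, $\mathbf{1}=\sum_{p\in S} e_p$, $I$ is the identity matrix, and $h^2$ denotes the entrywise square of $h$. The Poisson solution $h$ exists, is unique, and equals $\sum_{s=0}^\infty K^s\bar f$ with $\bar f=f-(f^T\mu)\mathbf{1}$. For an irreducible stochastic matrix $Q$ on $S$, $\mu(Q)$ is its stationary distribution; more precisely $Q\mapsto\mu(Q)\in\mathbb{R}^S$ denotes a fixed continuously differentiable extension of this map to an open neighborhood of the set of irreducible stochastic matrices on $S$ (inside all real $S\times S$ matrices), satisfying $\mu(Q)^TQ=\mu(Q)^T$ and $\mu(Q)^T\mathbf{1}=1$ whenever $Q\mathbf{1}=\mathbf{1}$. Such an extension is known to exist. One writes $\mu=\mu(K)$. *)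

(* Defs.v *)
From HB Require Import structures.
From mathcomp Require Import all_boot all_order all_algebra.
From mathcomp Require Import finmap.
From mathcomp Require Import all_classical all_reals all_analysis.

Set Implicit Arguments.
Unset Strict Implicit.
Unset Printing Implicit Defensive.

Import Order.TTheory GRing.Theory Num.Theory.
Import numFieldTopology.Exports numFieldNormedType.Exports.

Local Open Scope classical_set_scope.
Local Open Scope ring_scope.

(* The finite state space S is 'I_n; vectors indexed by S are column vectors. *)

Section Vectors.
Context {R : realType} {n : nat}.

Definition evec (p : 'I_n) : 'cV[R]_n := delta_mx p 0.

Definition ones : 'cV[R]_n := const_mx 1.

(* The scalar x^T y. *)
Definition dotv (x y : 'cV[R]_n) : R := (x^T *m y) 0 0.

Definition sqv (x : 'cV[R]_n) : 'cV[R]_n := map_mx (fun a => a ^+ 2) x.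

End Vectors.

Section Chains.
Context {R : realType} {n : nat}.
Implicit Types (K Q : 'M[R]_n) (mu : 'cV[R]_n).

Definition stochastic Q : Prop :=
  (forall p q, 0 <= Q p q) /\ (forall p, \sum_q Q p q = 1).

Definition irreducible_mx Q : Prop :=
  forall p q, exists k : nat, 0 < (Q ^+ k) p q.

(* For every p, the gcd of the return times to p is 1. *)
Definition aperiodic_mx Q : Prop :=
  forall (p : 'I_n) (d : nat),
    (forall k : nat, (0 < k)%N -> 0 < (Q ^+ k) p p -> (d %| k)%N) -> d = 1%N.

Definition stationary Q mu : Prop :=
  [/\ forall p, 0 <= mu p 0, \sum_p mu p 0 = 1 & mu^T *m Q = mu^T].

Definition poisson_solution K mu (f h : 'cV[R]_n) : Prop :=
  (1%:M - K) *m h = f - dotv f mu *: ones /\ dotv h mu = 0.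

End Chains.

(* Continuous differentiability on an open set U; the derivative is continuous
   for the operator norm. *)
Definition C1_on {R : realType} {V W : normedModType R} (U : set V)
    (g : V -> W) : Prop :=
  (forall x, U x -> differentiable g x) /\
  (forall x, U x -> forall e : R, 0 < e ->
    \forall y \near x, forall v : V,
      `|'d g y v - 'd g x v| <= e * `|v|).

Definition stationary_extension {R : realType} {n : nat} (U : set 'M[R]_n)
    (m : 'M[R]_n -> 'cV[R]_n) : Prop :=
  [/\ open U,
      forall Q, stochastic Q -> irreducible_mx Q -> U Q,
      C1_on U m,
      forall Q, stochastic Q -> irreducible_mx Q -> stationary Q (m Q) &
      forall Q, U Q -> Q *m ones = ones ->
        (m Q)^T *m Q = (m Q)^T /\ (m Q)^T *m ones = 1%:M].

(* Square matrices with their Borel sigma-algebra. *)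
Definition borel_mx (R : realType) (n : nat) :=
  g_sigma_algebraType (@open 'M[R]_n).

(* Mutual independence of the random elements X i, for i in D. *)
Definition independent_on {d d'} {T : measurableType d} {R : realType}
    (P : probability T R) {M : measurableType d'} {I : choiceType}
    (D : set I) (X : I -> T -> M) : Prop :=
  forall (J : {fset I}) (E : I -> set M),
    [set` J] `<=` D -> (forall i, i \in J -> measurable (E i)) ->
    P (\bigcap_(i in [set` J]) (X i @^-1` E i)) =
    (\prod_(i <- J) P (X i @^-1` E i))%E.

Definition update_mx {R : realType} {n : nat} (K : 'M[R]_n) (p q : 'I_n) :
    'M[R]_n :=
  evec p *m (evec q)^T - evec p *m (evec p)^T *m K.

(* X is a random matrix distributed as update_mx K p q, where the pair (p, q),
   p \in u, is drawn with probability nu_p K_pq. Different pairs can yield the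
   same matrix (row p of update_mx K p q may vanish), so the law is given by
   its values on all Borel sets. *)
Definition has_update_law {d} {T : measurableType d} {R : realType} {n : nat}
    (P : probability T R) (K : 'M[R]_n) (u : {set 'I_n}) (nu : 'cV[R]_n)
    (X : T -> borel_mx R n) : Prop :=
  measurable_fun [set: T] X /\
  forall E : set (borel_mx R n), measurable E ->
    P (X @^-1` E) =
    (\sum_(p in u) \sum_(q | update_mx K p q \in E) nu p 0 * K p q)%:E.

Definition Bmx {R : realType} {n : nat} {T : Type} (B : {set {set 'I_n}})
    (lambda : {set 'I_n} -> R) (A : {set 'I_n} -> nat -> T -> 'M[R]_n)
    (N : nat) (w : T) : 'M[R]_n :=
  Num.sqrt N%:R *:
    \sum_(u in B) ((Num.truncn (N%:R * lambda u))%:R^-1 *: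
      \sum_(1 <= k < (Num.truncn (N%:R * lambda u)).+1) A u k w).

(* Main.v *)
Require Import Defs.
From HB Require Import structures.
From mathcomp Require Import all_boot all_order all_algebra.
From mathcomp Require Import finmap.
From mathcomp Require Import all_classical all_reals all_analysis.
From mathcomp Require Import measurable_realfun.

Import Order.TTheory GRing.Theory Num.Theory.
Import numFieldTopology.Exports numFieldNormedType.Exports.

Local Open Scope classical_set_scope.
Local Open Scope ring_scope.

Set Implicit Arguments.
Unset Strict Implicit.
Unset Printing Implicit Defensive.

(** Let [M] be a matrix with zero row sums and let [m] be the vector
    [muext (K + eps M)], for small [eps].  Then [m] is a left fixed vector of
    [K + eps M] with total mass 1, and pairing it with the Poisson equation
    [(I - K) h = f - (f^T mu) 1] gives the exact identity
      [m^T f = mu^T f + eps m^T M h]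
    ([stationary_mean_perturbation]).  By continuity [m] tends to [muext K] as
    [eps] tends to 0, and [muext K] is [mu] by uniqueness of the stationary
    distribution of an irreducible chain ([stationary_unique]).  Hence the
    derivative of [m^T f] at 0 is [mu^T M h] ([derive1_stationary_mean]).

    Differentiability of [muext] enters through linearity: the derivative in the
    direction [Bmx B lambda A N w] is a fixed continuous linear functional
    [stationary_slope] of that matrix for every sample point [w], hence a
    measurable weighted sum of the variables [stationary_slope (A u k w)].  The
    formula [mu^T M h] holds for zero row sums, hence almost surely for the
    sampled matrices, and this is enough to compute expectations.

    On the matrix updating row [p] towards [q], the functional takes the value
    [mu_p (h_q - (K h)_p)].  Under the transition probabilities [K_pq] this is
    centered, with second moment [mu_p^2 ((K h^2)_p - (K h)_p^2)]
    ([update_mean_eq0], [update_second_moment]).  By independence the cross terms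
    of the squared weighted sum have mean zero ([expectation_sqr_sum]), so the
    second moment of the derivative is exactly
      [\sum_u N / floor (N lambda_u) * S_u],
    with [S_u] the second moment of one sample from [u]
    ([second_moment_derivative]); the limit follows from
    [N / floor (N lambda_u) --> 1 / lambda_u]. *)

(** * Stationary distributions of irreducible chains *)

Lemma stochastic_ones (R : realType) (n : nat) (K : 'M[R]_n) :
  stochastic K -> K *m ones = ones.
Proof.
move=> [_ Krow]; apply/colP => p; rewrite !mxE -[RHS](Krow p).
by apply: eq_bigr => q _; rewrite mxE mulr1.
Qed.

Lemma stationary_iter (R : realType) (n : nat) (K : 'M[R]_n) (v : 'cV[R]_n) k :
  v^T *m K = v^T -> v^T *m K ^+ k = v^T.
Proof.
move=> vK; elim: k => [|k IHk]; first by rewrite expr0 mulmx1.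
by rewrite exprS mulmxA vK.
Qed.

Lemma mx_pow_ge0 (R : realType) (n : nat) (K : 'M[R]_n) k p q :
  (forall p q, 0 <= K p q) -> 0 <= (K ^+ k) p q.
Proof.
move=> K0; elim: k p q => [|k IHk] p q.
  by rewrite expr0 mxE; case: (p == q).
by rewrite exprS mxE sumr_ge0// => i _; rewrite mulr_ge0.
Qed.

(** The mass at [p] equals the sum over [q] of [w_q (K^k)_qp], a sum of
    nonnegative terms; if it vanishes, every [q] from which [p] is reachable in
    [k] steps has [w_q = 0], and irreducibility reaches every [q]. *)
Lemma irreducible_left_fixed_eq0 (R : realType) (n : nat) (K : 'M[R]_n)
    (w : 'cV[R]_n) (p : 'I_n) :
  stochastic K -> irreducible_mx K -> w^T *m K = w^T ->
  (forall q, 0 <= w q 0) -> w p 0 = 0 -> w = 0.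
Proof.
move=> [K0 _] Kirr wK w0 wp0; apply/colP => q; rewrite [RHS]mxE.
have [k Kk] := Kirr q p.
have := congr1 (fun M : 'rV_n => M 0 p) (stationary_iter k wK).
rewrite /= mxE [RHS]mxE wp0 => /eqP; rewrite psumr_eq0; last first.
  by move=> i _; rewrite mxE mulr_ge0// mx_pow_ge0.
move=> /allP /(_ q (mem_index_enum _)); rewrite mxE /= mulf_eq0.
by rewrite (gt_eqF Kk) orbF => /eqP.
Qed.

(** Subtracting from [m] the largest multiple of [mu] that keeps it nonnegative
    gives a nonnegative left fixed vector with a zero entry, hence the zero
    vector; so [m] and [mu] are proportional, with the same total mass. *)
Lemma stationary_unique (R : realType) (n : nat) (K : 'M[R]_n)
    (mu m : 'cV[R]_n) :
  stochastic K -> irreducible_mx K -> stationary K mu -> stationary K m ->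
  m = mu.
Proof.
move=> Ks Ki [mu0 mu1 muK] [m0 m1 mK].
have mu_gt0 p : 0 < mu p 0.
  rewrite lt_def mu0 andbT; apply/eqP => mup0.
  have mu_eq0 := irreducible_left_fixed_eq0 Ks Ki muK mu0 mup0.
  move: mu1; rewrite mu_eq0 big1 => [/eqP|i _]; last by rewrite mxE.
  by rewrite eq_sym oner_eq0.
case: (pickP 'I_n) => [p0 _|no_p]; last by apply/colP => p; have := no_p p.
pose ratio p := m p 0 / mu p 0.
pose pm := [arg min_(p < p0) ratio p]%O.
have ratio_min q : ratio pm <= ratio q.
  by rewrite /pm; case: arg_minP => // i _; apply.
pose w := m - ratio pm *: mu.
have w_eq0 : w = 0.
  apply: (@irreducible_left_fixed_eq0 _ _ K _ pm) => //.
  - by rewrite /w linearB linearZ /= mulmxBl mK -scalemxAl muK.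
  - by move=> q; rewrite !mxE subr_ge0 -ler_pdivlMr//; exact: ratio_min.
  - by rewrite !mxE /ratio divfK ?subrr// gt_eqF.
have mE : m = ratio pm *: mu by apply/eqP; rewrite -subr_eq0 -/w w_eq0.
suff -> : m = 1 *: mu by rewrite scale1r.
rewrite {1}mE; congr (_ *: _).
rewrite -m1 mE; under eq_bigr do rewrite mxE.
by rewrite -mulr_sumr mu1 mulr1.
Qed.

(** * Perturbation of stationary averages *)

Section DotProduct.
Context {R : realType} {n : nat}.
Implicit Types (x y m f h : 'cV[R]_n).

Lemma dotvZl (a : R) (x f : 'cV[R]_n) : dotv (a *: x) f = a * dotv x f.
Proof. by rewrite /dotv linearZ -scalemxAl mxE. Qed.

Lemma dotvDl (x y f : 'cV[R]_n) : dotv (x + y) f = dotv x f + dotv y f.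
Proof. by rewrite /dotv linearD mulmxDl mxE. Qed.

Lemma dotvBl (x y f : 'cV[R]_n) : dotv (x - y) f = dotv x f - dotv y f.
Proof. by rewrite -scaleN1r dotvDl dotvZl mulN1r. Qed.

Lemma dotvE (x y : 'cV[R]_n) : dotv x y = \sum_p x p 0 * y p 0.
Proof. by rewrite /dotv mxE; apply: eq_bigr => p _; rewrite mxE. Qed.

Lemma dotvDr m f h : dotv m (f + h) = dotv m f + dotv m h.
Proof. by rewrite /dotv mulmxDr mxE. Qed.

Lemma dotvZr (a : R) m f : dotv m (a *: f) = a * dotv m f.
Proof. by rewrite /dotv -scalemxAr mxE. Qed.

Lemma dotv_continuous f : continuous (fun x : 'cV[R]_n => dotv x f).
Proof.
rewrite (_ : dotv^~ f = fun x => \sum_p x p 0 * f p 0); last first.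
  by apply/funext => x; exact: dotvE.
apply: continuous_big; first exact: add_continuous.
move=> p _ x; have x_cont := @coord_continuous R n 1 p 0 x.
have f_cont : {for x, continuous (fun=> f p 0)} by exact: cst_continuous.
exact: (cvgM x_cont f_cont).
Qed.

End DotProduct.

Section Perturbation.
Context {R : realType} {n : nat}.
Implicit Types (K M Q : 'M[R]_n) (f h m mu : 'cV[R]_n).

(** Exhibits the derivative in the statement as a linear function of the
    direction [M], for all [M], including those with nonzero row sums. *)
Lemma derive1_dotv_diff (m : 'M[R]_n -> 'cV[R]_n) K M f :
  differentiable m K ->
  derive1 (fun eps : R => dotv (m (K + eps *: M)) f) 0 = dotv ('d m K M) f.
Proof.
move=> mK; apply/cvg_lim; first exact: norm_hausdorff.
have quot_cvg : h^-1 *: ((m \o shift K) (h *: M) - m K) @[h --> 0^']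
    --> 'd m K M.
  by rewrite -deriveE//; exact: (diff_derivable (v := M) mK).
have := cvg_comp _ _ quot_cvg (@dotv_continuous R n f ('d m K M)).
apply: cvg_trans; apply: near_eq_cvg; near=> h => /=.
by rewrite dotvZl dotvBl addr0 scale0r addr0 (addrC K).
Unshelve. all: by end_near. Qed.

(** Pair the Poisson equation of [K] with [m]: since [m^T = m^T Q], the term
    [m^T (I - K) h] is [m^T (Q - K) h].  The identity is exact, with no
    restriction on the distance between [Q] and [K]. *)
Lemma stationary_mean_perturbation K Q mu f h m :
  poisson_solution K mu f h -> m^T *m Q = m^T -> m^T *m ones = 1%:M ->
  dotv m f = dotv f mu + dotv m ((Q - K) *m h).
Proof.
move=> [hK _] mQ m1.
have fE : f = (1%:M - K) *m h + dotv f mu *: ones by rewrite hK subrK.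
rewrite {1}fE dotvDr dotvZr [dotv m ones]/dotv m1 mxE eqxx mulr1 addrC.
by rewrite /dotv !mulmxA !mulmxBr mQ mulmx1.
Qed.

(** Near [eps = 0] the function is [f^T mu + eps * k eps] with [k] continuous at
    0, so its derivative is [k 0].  Zero row sums of [M] are what keeps
    [K + eps M] fixing the vector of ones, so that [muext] remains a left fixed
    vector along the whole segment. *)
Lemma derive1_stationary_mean (U : set 'M[R]_n) (muext : 'M[R]_n -> 'cV[R]_n)
    K M mu f h :
  stationary_extension U muext -> stochastic K -> irreducible_mx K ->
  stationary K mu -> poisson_solution K mu f h -> M *m ones = 0 ->
  derive1 (fun eps : R => dotv (muext (K + eps *: M)) f) 0 =
  dotv mu (M *m h).
Proof.
move=> [Uopen UK [Udiff _] ext_stat ext_eq] Ks Ki Kmu hK M1.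
have muextK : muext K = mu.
  by apply: stationary_unique Kmu _ => //; exact: ext_stat.
have K1 := stochastic_ones Ks.
have line_cont : continuous (fun eps : R => K + eps *: M).
  move=> eps.
  have K_cont : {for eps, continuous (fun=> K)} by exact: cst_continuous.
  have M_cont : {for eps, continuous (fun eps : R => eps *: M)}.
    by apply: continuousZr_tmp => V.
  exact: (continuousD K_cont M_cont).
have line0 : K + 0 *: M = K by rewrite scale0r addr0.
have mean_near : \forall eps \near (0 : R), dotv (muext (K + eps *: M)) f =
    dotv f mu + eps * dotv (muext (K + eps *: M)) (M *m h).
  have : \forall eps \near (0 : R), U (K + eps *: M).
    apply: line_cont; rewrite line0; apply: open_nbhs_nbhs.
    by split=> //; exact: UK.
  apply: filterS => eps Ueps.
  have [] := ext_eq _ Ueps.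
    by rewrite mulmxDl K1 -scalemxAl M1 scaler0 addr0.
  move=> mQ m1; rewrite (stationary_mean_perturbation hK mQ m1).
  by rewrite addrAC subrr add0r -scalemxAl dotvZr.
apply/cvg_lim; first exact: norm_hausdorff.
pose slope eps : R := dotv (muext (K + eps *: M)) (M *m h).
have slope_cont : {for 0, continuous slope}.
  apply: (@continuous_comp _ _ _ (fun eps : R => muext (K + eps *: M))
    (fun m => dotv m (M *m h))); last exact: dotv_continuous.
  apply: (@continuous_comp _ _ _ (fun eps : R => K + eps *: M) muext).
    exact: line_cont.
  by rewrite line0; apply: differentiable_continuous; apply: Udiff; exact: UK.
have slope_cvg : slope eps @[eps --> 0^'] --> dotv mu (M *m h).
  have <- : slope 0 = dotv mu (M *m h) by rewrite /slope line0 muextK.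
  by apply: cvg_within_filter; exact: slope_cont.
apply: cvg_trans slope_cvg; apply: near_eq_cvg; near=> eps => /=.
have eps_neq0 : eps != 0 by near: eps; exact: nbhs_dnbhs_neq.
rewrite addr0 line0 muextK (near (nbhs_dnbhs mean_near) eps)//.
have := nbhs_singleton mean_near; rewrite /= mul0r addr0 line0 muextK => ->.
by rewrite addrAC subrr add0r /GRing.scale /= mulKf.
Unshelve. all: by end_near. Qed.

End Perturbation.

(** * Second moments of sums of independent finitely valued variables *)

Section Means.
Context {d : measure_display} {T : measurableType d} {R : realType}.
Variable P : probability T R.
Implicit Types (X Y : T -> R).

(** Integrability is bundled with the value of the integral so that the
    predicate is stable under finite linear combinations. *)
Definition has_mean X (m : R) : Prop :=
  P.-integrable [set: T] (EFin \o X) /\ (\int[P]_w (X w)%:E)%E = m%:E.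

Lemma has_mean_expectation X m : has_mean X m -> 'E_P[X]%E = m%:E.
Proof. by move=> [_ <-]; rewrite unlock. Qed.

Lemma has_mean_indic (E : set T) : measurable E -> has_mean \1_E (fine (P E)).
Proof.
move=> mE; split; first exact: integrable_indic.
by rewrite integral_indic// setIT fineK// fin_num_measure.
Qed.

Lemma has_meanZ (a : R) X m :
  has_mean X m -> has_mean (fun w => a * X w) (a * m).
Proof.
move=> [iX EX]; split; first exact: (integrableZl measurableT a iX).
under eq_integral do rewrite EFinM.
by rewrite (integralZl measurableT iX) EX.
Qed.

Lemma has_mean_sum (J : eqType) (r : seq J) (X : J -> T -> R) (m : J -> R) :
  (forall j, j \in r -> has_mean (X j) (m j)) ->
  has_mean (fun w => \sum_(j <- r) X j w) (\sum_(j <- r) m j).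
Proof.
elim: r => [_|j r IHr mean_r].
  rewrite big_nil; split.
    by apply: eq_integrable (integrable0 _ _) => // w _; rewrite /= big_nil.
  under eq_integral do rewrite big_nil.
  by rewrite integral0.
have [ij Ej] := mean_r j (mem_head j r).
have [ir Er] : has_mean (fun w => \sum_(j <- r) X j w) (\sum_(j <- r) m j).
  by apply: IHr => k kr; apply: mean_r; rewrite inE kr orbT.
split.
  apply: eq_integrable (integrableD measurableT ij ir) => // w _.
  by rewrite /= big_cons EFinD.
rewrite big_cons EFinD -Ej -Er -(integralD_EFin measurableT ij ir).
by apply: eq_integral => w _; rewrite big_cons.
Qed.

(** Lets the mean of a variable be computed on a finite combination of
    indicators that agrees with it outside a null set. *)
Lemma has_mean_ae (N : set T) X Y m :
  measurable_fun [set: T] X -> measurable N -> P N = 0 ->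
  (forall w, ~ N w -> X w = Y w) -> has_mean Y m -> has_mean X m.
Proof.
move=> mX mN PN0 XY [iY EY].
have /measurable_EFinP mX' := mX.
have [mY fY] := integrableP _ _ _ iY.
have XYae : ae_eq P [set: T] (EFin \o X) (EFin \o Y).
  exists N; split=> // w /= XYw; apply: contrapT => /XY Xw.
  by apply: XYw => _; rewrite /= Xw.
split; last by rewrite -EY; exact: ae_eq_integral.
apply/integrableP; split=> //.
suff -> : (\int[P]_w `|(EFin \o X) w| = \int[P]_w `|(EFin \o Y) w|)%E by [].
apply: ae_eq_integral => //; last exact: ae_eq_abse.
- exact: measurableT_comp.
- exact: measurableT_comp.
Qed.

End Means.

Section FinitelyValued.
Context {d d' : measure_display} {T : measurableType d} {R : realType}.
Context {M : measurableType d'} {I : choiceType}.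
Variables (P : probability T R) (D : set I) (X : I -> T -> M) (V : seq M).
Hypothesis X_measurable : forall i, D i -> measurable_fun [set: T] (X i).
Hypothesis V_uniq : uniq V.
Hypothesis V_measurable : forall v, v \in V -> measurable [set v].
Hypothesis X_in_V : forall i, D i -> P (X i @^-1` ~` [set` V]) = 0.

Definition mass i v : R := fine (P (X i @^-1` [set v])).

Lemma measurable_fiber i v : D i -> v \in V -> measurable (X i @^-1` [set v]).
Proof.
move=> Di Vv; rewrite -[X in measurable X]setTI.
by apply: X_measurable => //; exact: V_measurable.
Qed.

Lemma measurable_values : measurable [set` V].
Proof.
have -> : [set` V] = \big[setU/set0]_(v <- V) [set v].
  rewrite -bigcup_seq.
  by apply/seteqP; split => [v Vv|v [u Vu ->]]//; exists v.
rewrite big_seq; apply: bigsetU_measurable => v; exact: V_measurable.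
Qed.

Lemma measurable_exceptional i : D i -> measurable (X i @^-1` ~` [set` V]).
Proof.
move=> Di; rewrite -[X in measurable X]setTI; apply: X_measurable => //.
by apply: measurableC; exact: measurable_values.
Qed.

Lemma sum_fibers i (G : M -> R) w : X i w \in V ->
  G (X i w) = \sum_(v <- V) G v * \1_(X i @^-1` [set v]) w.
Proof.
move=> XV; rewrite (bigD1_seq (X i w))//= indicE mem_set// mulr1.
rewrite big1 ?addr0// => v vX; rewrite indicE memNset ?mulr0//= => Xv.
by rewrite Xv eqxx in vX.
Qed.

(** Outside a null set [G (X i)] is the simple function of [sum_fibers]. *)
Lemma has_mean_comp i (G : M -> R) : D i -> measurable_fun [set: M] G ->
  has_mean P (fun w => G (X i w)) (\sum_(v <- V) G v * mass i v).
Proof.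
move=> Di mG.
apply: (@has_mean_ae _ _ _ _ (X i @^-1` ~` [set` V]) _
  (fun w => \sum_(v <- V) G v * \1_(X i @^-1` [set v]) w)).
- by apply: (measurableT_comp mG); exact: X_measurable.
- exact: measurable_exceptional.
- exact: X_in_V.
- by move=> w /= /contrapT XV; exact: sum_fibers.
- apply: has_mean_sum => v Vv; apply: has_meanZ; apply: has_mean_indic.
  exact: measurable_fiber.
Qed.

Hypothesis X_indep : independent_on P D X.

Lemma independent_pair i j (E F : set M) : D i -> D j -> i != j ->
  measurable E -> measurable F ->
  P (X i @^-1` E `&` X j @^-1` F) = (P (X i @^-1` E) * P (X j @^-1` F))%E.
Proof.
move=> Di Dj ij mE mF.
have := X_indep (J := [fset i; j]%fset) (E := fun k => if k == i then E else F).
rewrite set_fsetU !set_fset1 bigcap_setU !bigcap_set1.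
rewrite big_fsetU1 ?inE//= big_seq_fset1 eqxx eq_sym (negbTE ij).
by apply => [k [->|->]//|k _]; case: ifP.
Qed.

(** Both factors are almost surely combinations of indicators of fibers, and
    independence factors the probability of each intersection of fibers. *)
Lemma has_mean_indep i j (G H : M -> R) : D i -> D j -> i != j ->
  measurable_fun [set: M] G -> measurable_fun [set: M] H ->
  has_mean P (fun w => G (X i w) * H (X j w))
    ((\sum_(v <- V) G v * mass i v) * (\sum_(v <- V) H v * mass j v)).
Proof.
move=> Di Dj ij mG mH.
pose N := (X i @^-1` (~` [set` V])) `|` (X j @^-1` (~` [set` V])).
pose Y w := \sum_(v <- V) \sum_(u <- V) (G v * H u) *
  \1_(X i @^-1` [set v] `&` X j @^-1` [set u]) w.
apply: (@has_mean_ae _ _ _ P N _ Y); rewrite {}/N {}/Y.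
- apply: measurable_funM.
  + by apply: (measurableT_comp mG); exact: X_measurable.
  + by apply: (measurableT_comp mH); exact: X_measurable.
- by apply: measurableU; exact: measurable_exceptional.
- apply/eqP; rewrite eq_le measure_ge0 andbT.
  rewrite -[leRHS](adde0 0%E).
  rewrite -[X in (_ <= X + _)%E](X_in_V Di) -[X in (_ <= _ + X)%E](X_in_V Dj).
  by apply: measureU2; exact: measurable_exceptional.
- move=> w /not_orP [/= /contrapT XiV /contrapT XjV].
  rewrite (sum_fibers _ XiV) (sum_fibers _ XjV) big_distrlr /=.
  by apply: eq_bigr => v _; apply: eq_bigr => u _; rewrite indicI mulrACA.
- rewrite big_distrlr /=.
  apply: has_mean_sum => v Vv; apply: has_mean_sum => u Vu.
  rewrite mulrACA; apply: has_meanZ.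
  have mv := measurable_fiber Di Vv; have mu := measurable_fiber Dj Vu.
  rewrite -fineM ?fin_num_measure// -independent_pair//;
    try exact: V_measurable.
  by apply: has_mean_indic; exact: measurableI.
Qed.

(** Expand the square: the off-diagonal terms have mean zero by independence and
    centering, so only the diagonal terms contribute. *)
Lemma expectation_sqr_sum (s : seq I) (c : I -> R) (G : M -> R) :
  uniq s -> (forall i, i \in s -> D i) -> measurable_fun [set: M] G ->
  (forall i, i \in s -> \sum_(v <- V) G v * mass i v = 0) ->
  'E_P[fun w => ((\sum_(i <- s) c i * G (X i w)) ^+ 2)%R]%E =
  (\sum_(i <- s) c i ^+ 2 * \sum_(v <- V) G v ^+ 2 * mass i v)%:E.
Proof.
move=> s_uniq sD mG G0; apply: has_mean_expectation.
rewrite (_ : (fun w => _) = fun w => \sum_(i <- s) \sum_(j <- s)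
    (c i * c j) * (G (X i w) * G (X j w))); last first.
  apply/funext => w; rewrite expr2 big_distrlr /=.
  by apply: eq_bigr => i _; apply: eq_bigr => j _; rewrite mulrACA.
apply: has_mean_sum => i si.
rewrite (_ : _ * _ = \sum_(j <- s) (c i * c j) *
    (if j == i then \sum_(v <- V) G v ^+ 2 * mass i v else 0)); last first.
  rewrite (bigD1_seq i)//= eqxx [X in _ + X]big1 ?addr0 ?expr2// => j /negbTE ->.
  by rewrite mulr0.
apply: has_mean_sum => j sj; apply: has_meanZ; case: eqVneq => [->|ji].
  apply: (has_mean_comp (G := fun x => G x ^+ 2)); first exact: sD.
  exact: measurable_funX.
have := has_mean_indep (sD i si) (sD j sj) _ mG mG.
by rewrite G0// mul0r eq_sym; apply.
Qed.

End FinitelyValued.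

(** * The law of one sampled update *)

Section BorelMatrices.
Context {R : realType} {n : nat}.

Lemma measurable_open_mx (E : set (borel_mx R n)) :
  open (E : set 'M[R]_n) -> measurable E.
Proof. by move=> oE; exact: sub_gen_smallest. Qed.

Lemma measurable_set1_mx (M : borel_mx R n) : measurable [set M].
Proof.
rewrite -[[set M]]setCK; apply: measurableC; apply: measurable_open_mx.
apply: closed_openC; apply: accessible_closed_set1.
by apply: hausdorff_accessible; exact: norm_hausdorff.
Qed.

Lemma measurable_continuous_mx (G : 'M[R]_n -> R) :
  continuous G -> measurable_fun [set: borel_mx R n] (G : borel_mx R n -> R).
Proof.
move=> /continuousP cG; apply: (measurability _ (RGenOpens.measurableE R)).
move=> _ [_ [a [b ->] <-]]; rewrite setTI; apply: measurable_open_mx.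
by apply: cG; exact: interval_open.
Qed.

End BorelMatrices.

Section UpdateLaw.
Context {R : realType} {n : nat}.
Variable K : 'M[R]_n.

(** Distinct pairs [(p, q)] may give the same matrix; duplicates are removed so
    that the fibers over [updates] are disjoint. *)
Definition updates : seq (borel_mx R n) :=
  undup [seq update_mx K pq.1 pq.2 | pq : 'I_n * 'I_n].

Lemma mem_updates p q : update_mx K p q \in updates.
Proof. by rewrite mem_undup; apply/mapP; exists (p, q); rewrite ?mem_enum. Qed.

Lemma updates_uniq : uniq updates.
Proof. exact: undup_uniq. Qed.

Context {d : measure_display} {T : measurableType d}.
Variables (P : probability T R) (u : {set 'I_n}) (nu : 'cV[R]_n).
Variable X : T -> borel_mx R n.
Hypothesis X_law : has_update_law P K u nu X.

Lemma update_law_in_updates : P (X @^-1` ~` [set` updates]) = 0.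
Proof.
rewrite X_law.2.
  rewrite big1 // => p _; rewrite big1 // => q.
  by rewrite inE /= mem_updates.
apply: measurableC; apply: measurable_values => v _; exact: measurable_set1_mx.
Qed.

(** Summing over values [v] and over pairs [(p, q)] gives the same result, since
    the mass of [v] collects exactly the pairs whose update is [v]. *)
Lemma update_law_mean (G : 'M[R]_n -> R) :
  \sum_(v <- updates) G v * fine (P (X @^-1` [set v])) =
  \sum_(p in u) \sum_q nu p 0 * K p q * G (update_mx K p q).
Proof.
transitivity (\sum_(v <- updates) \sum_(p in u)
    \sum_q (if update_mx K p q == v then nu p 0 * K p q * G v else 0)).
  apply: eq_bigr => v _; rewrite X_law.2 /=; last exact: measurable_set1_mx.
  rewrite mulr_sumr; apply: eq_bigr => p _.
  rewrite mulr_sumr -big_mkcond /=; apply: eq_big => q; last by rewrite mulrC.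
  by apply/idP/eqP; rewrite inE.
rewrite exchange_big; apply: eq_bigr => p _ /=.
rewrite exchange_big; apply: eq_bigr => q _ /=.
rewrite (bigD1_seq (update_mx K p q)) ?mem_updates ?updates_uniq//= eqxx.
by rewrite big1 ?addr0// => v /negbTE; rewrite eq_sym => ->.
Qed.

End UpdateLaw.

Section UpdateMoments.
Context {R : realType} {n : nat}.
Variable K : 'M[R]_n.
Hypothesis K_stoch : stochastic K.
Implicit Types (mu h nu : 'cV[R]_n) (u : {set 'I_n}).

(** An update alters row [p] only, replacing the conditional mean [(K h)_p] by
    the sampled value [h_q]. *)
Lemma update_mxE p q h :
  update_mx K p q *m h = (h q 0 - (K *m h) p 0) *: evec p.
Proof.
have evecTE i (x : 'cV[R]_n) : (evec i)^T *m x = (x i 0)%:M.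
  by rewrite trmx_delta -rowE; apply/rowP => j; rewrite !mxE !ord1.
rewrite /update_mx mulmxBl -!mulmxA !evecTE scalerBl.
by rewrite !mul_mx_scalar.
Qed.

Lemma update_mx_ones p q : update_mx K p q *m ones = 0.
Proof. by rewrite update_mxE stochastic_ones// !mxE subrr scale0r. Qed.

Lemma dotv_update mu h p q :
  dotv mu (update_mx K p q *m h) = mu p 0 * (h q 0 - (K *m h) p 0).
Proof.
rewrite update_mxE dotvZr mulrC; congr (_ * _).
by rewrite /dotv /evec -colE !mxE.
Qed.

(** The sampled value [h_q] has conditional mean [(K h)_p]. *)
Lemma update_mean_eq0 mu h nu u :
  \sum_(p in u) \sum_q nu p 0 * K p q * dotv mu (update_mx K p q *m h) = 0.
Proof.
rewrite big1// => p _.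
under eq_bigr do rewrite dotv_update mulrCA -!mulrA mulrBr.
rewrite -!mulr_sumr big_split /= sumrN -mulr_suml K_stoch.2 mul1r.
by rewrite !mxE subrr !mulr0.
Qed.

(** For each [p], the bracket is the variance of [h_q] with [q] drawn from row
    [p] of [K]. *)
Lemma update_second_moment mu h nu u :
  \sum_(p in u) \sum_q nu p 0 * K p q * dotv mu (update_mx K p q *m h) ^+ 2 =
  \sum_(p in u) nu p 0 * mu p 0 ^+ 2 *
    ((K *m sqv h) p 0 - (K *m h) p 0 ^+ 2).
Proof.
apply: eq_bigr => p _; set a := (K *m h) p 0.
have aE : a = \sum_q K p q * h q 0 by rewrite /a mxE.
have -> : (K *m sqv h) p 0 - a ^+ 2 = \sum_q K p q * (h q 0 - a) ^+ 2.
  rewrite mxE.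
  transitivity (\sum_q (K p q * h q 0 ^+ 2 - (K p q * h q 0) * (a *+ 2)
                         + K p q * a ^+ 2)).
    rewrite big_split sumrB /= -!mulr_suml -aE K_stoch.2 mul1r.
    under eq_bigr do rewrite mxE.
    by rewrite mulrnAr -expr2 mulr2n opprD addrA addrNK.
  apply: eq_bigr => q _; rewrite -(mulrA (K p q)) mulrnAr sqrrB.
  by rewrite [RHS]mulrDr [X in _ = X + _]mulrBr.
rewrite mulr_sumr; apply: eq_bigr => q _.
by rewrite dotv_update -/a exprMn mulrACA mulrA.
Qed.

End UpdateMoments.

Section SampleSizes.
Context {R : realType}.

(** The inverse ratio [floor (N a) / N] lies between [a - 1 / N] and [a]. *)
Lemma cvg_div_truncn (a : R) : 0 < a ->
  (fun N : nat => N%:R / (Num.truncn (N%:R * a))%:R) @ \oo --> a^-1.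
Proof.
move=> a0.
have inv_cvg : (fun N : nat => N%:R^-1 : R) @ \oo --> 0.
  apply/gtr0_cvgV0; last exact: cvgr_idn.
  by near=> N; rewrite ltr0n; near: N; exact: nbhs_infty_gt.
rewrite (_ : (fun N => _) =
    fun N => ((Num.truncn (N%:R * a))%:R / N%:R)^-1); last first.
  by apply/funext => N; rewrite invf_div.
apply: cvgV; first by rewrite gt_eqF.
apply: (@squeeze_cvgr _ _ _ _ (fun N : nat => a - N%:R^-1) (fun=> a)).
- near=> N.
  have N0 : 0 < N%:R :> R by rewrite ltr0n; near: N; exact: nbhs_infty_gt.
  have /truncn_itv /andP[lo hi] : 0 <= N%:R * a by rewrite mulr_ge0// ltW.
  rewrite ler_pdivrMr// [a * _]mulrC lo andbT ler_pdivlMr//.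
  by rewrite mulrBl mulVf ?gt_eqF// lerBlDr natr1 [a * _]mulrC ltW.
- rewrite -[X in _ --> X]subr0; apply: cvgB => //; exact: cvg_cst.
- exact: cvg_cst.
Unshelve. all: by end_near. Qed.

End SampleSizes.

(** * Aggregated samples *)

Section Sampling.
Context {R : realType} {n : nat} {T : Type}.
Variables (B : {set {set 'I_n}}) (lambda : {set 'I_n} -> R).

Definition sample_size (N : nat) (u : {set 'I_n}) : nat :=
  Num.truncn (N%:R * lambda u).

Definition sample_index (N : nat) : seq ({set 'I_n} * nat) :=
  [seq (u, k) | u <- enum B, k <- index_iota 1 (sample_size N u).+1].

Definition sample_weight (N : nat) (i : {set 'I_n} * nat) : R :=
  Num.sqrt N%:R * (sample_size N i.1)%:R^-1.

Lemma sample_index_uniq N : uniq (sample_index N).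
Proof.
apply: allpairs_uniq_dep; first exact: enum_uniq.
- by move=> u _; exact: iota_uniq.
- by move=> [u k] [v l] _ _ /= [-> ->].
Qed.

Lemma mem_sample_index N i :
  i \in sample_index N -> (i.1 \in B) && (0 < i.2)%N.
Proof.
move=> /allpairsPdep[u [k [uB + ->]]] /=.
by rewrite mem_index_iota => /andP[-> _]; rewrite andbT -mem_enum.
Qed.

Lemma sum_sample_index N (F : {set 'I_n} * nat -> R) :
  \sum_(i <- sample_index N) F i =
  \sum_(u in B) \sum_(1 <= k < (sample_size N u).+1) F (u, k).
Proof. by rewrite big_allpairs_dep /= big_enum. Qed.

Lemma linear_Bmx (L : {scalar 'M[R]_n}) A N (w : T) :
  L (Bmx B lambda A N w) =
  \sum_(i <- sample_index N) sample_weight N i * L (A i.1 i.2 w).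
Proof.
rewrite /Bmx linearZ linear_sum sum_sample_index /= mulr_sumr.
apply: eq_bigr => u _; by rewrite linearZ linear_sum /= mulrA mulr_sumr.
Qed.

(** A class with [m] samples contributes [m] equal terms [N / m^2], that is
    [N / m]; when [m = 0] both vanish because the inverse of 0 is 0. *)
Lemma sum_sqr_sample_weight N (s : {set 'I_n} -> R) :
  \sum_(i <- sample_index N) sample_weight N i ^+ 2 * s i.1 =
  \sum_(u in B) N%:R / (sample_size N u)%:R * s u.
Proof.
rewrite sum_sample_index; apply: eq_bigr => u _.
rewrite /sample_weight /= big_const_nat subn1 /= iter_addr_0.
rewrite exprMn sqr_sqrtr ?ler0n// -mulrnAl -mulrnAr; congr (_ * _ * _).
have [->|m0] := posnP (sample_size N u); first by rewrite invr0 mulr0n.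
rewrite expr2 -mulrnAr -[X in _ * X]mulr_natr mulVf ?mulr1//.
by rewrite pnatr_eq0 -lt0n.
Qed.

End Sampling.

Section StationarySlope.
Context {R : realType} {n : nat}.
Variables (U : set 'M[R]_n) (muext : 'M[R]_n -> 'cV[R]_n).
Hypothesis hext : stationary_extension U muext.
Variables (K : 'M[R]_n) (mu f h : 'cV[R]_n).
Hypotheses (Kstoch : stochastic K) (Kirr : irreducible_mx K).
Hypotheses (hmu : stationary K mu) (hh : poisson_solution K mu f h).

Definition stationary_slope (M : 'M[R]_n) : R := dotv ('d muext K M) f.

Lemma muext_differentiable : differentiable muext K.
Proof. by case: hext => _ UK [Udiff _] _ _; apply: Udiff; exact: UK. Qed.

Lemma stationary_slope_linear : linear stationary_slope.
Proof. by move=> a M M'; rewrite /stationary_slope linearP dotvDl dotvZl. Qed.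

HB.instance Definition _ := GRing.isLinear.Build R 'M[R]_n R *%R
  stationary_slope stationary_slope_linear.

Lemma stationary_slope_continuous : continuous stationary_slope.
Proof.
move=> M; apply: (@continuous_comp _ _ _ ('d muext K) (dotv^~ f)).
  exact: (diff_continuous muext_differentiable).
exact: dotv_continuous.
Qed.

Lemma stationary_slope_update p q :
  stationary_slope (update_mx K p q) = dotv mu (update_mx K p q *m h).
Proof.
rewrite /stationary_slope -derive1_dotv_diff; last exact: muext_differentiable.
by rewrite (derive1_stationary_mean hext _ _ hmu hh)// update_mx_ones.
Qed.

Variables (B : {set {set 'I_n}}) (lambda : {set 'I_n} -> R).
Variable nu : {set 'I_n} -> 'cV[R]_n.
Context {d : measure_display} {T : measurableType d}.
Variables (P : probability T R) (A : {set 'I_n} -> nat -> T -> borel_mx R n).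
Hypothesis A_law : forall u k, u \in B -> (0 < k)%N ->
  has_update_law P K u (nu u) (A u k).
Hypothesis A_indep : independent_on P
  [set i : {set 'I_n} * nat | (i.1 \in B) && (0 < i.2)%N]
  (fun i => A i.1 i.2).

(** The derivative is an everywhere measurable weighted sum of independent
    variables that are centered and almost surely finitely valued, so
    [expectation_sqr_sum] gives its second moment for every [N], including those
    for which some class receives no sample. *)
Lemma second_moment_derivative N :
  'E_P[fun w : T => (derive1 (fun eps : R =>
     dotv (muext (K + eps *: Bmx B lambda A N w)) f) 0 ^+ 2)%R]%E =
  (\sum_(u in B) N%:R / (Num.truncn (N%:R * lambda u))%:R *
     \sum_(p in u) nu u p 0 * mu p 0 ^+ 2 *
       ((K *m sqv h) p 0 - (K *m h) p 0 ^+ 2))%:E.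
Proof.
rewrite (_ : (fun w => _) = fun w =>
    (\sum_(i <- sample_index B lambda N)
       sample_weight lambda N i * stationary_slope (A i.1 i.2 w)) ^+ 2);
  last first.
  apply/funext => w; rewrite derive1_dotv_diff; last exact: muext_differentiable.
  by rewrite -/(stationary_slope _) linear_Bmx.
pose D := [set i : {set 'I_n} * nat | (i.1 \in B) && (0 < i.2)%N].
have D_law i : D i -> has_update_law P K i.1 (nu i.1) (A i.1 i.2).
  by move=> /andP[iB i0]; exact: A_law.
rewrite (@expectation_sqr_sum _ _ _ _ _ _ P D (fun i => A i.1 i.2) (updates K)).
- congr (_%:E); rewrite -sum_sqr_sample_weight.
  rewrite big_seq [RHS]big_seq; apply: eq_bigr => i /mem_sample_index iD.
  congr (_ * _).
  rewrite /mass (update_law_mean (D_law i iD) (fun M => stationary_slope M ^+ 2)).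
  rewrite -(update_second_moment Kstoch).
  apply: eq_bigr => p _; apply: eq_bigr => q _.
  by rewrite stationary_slope_update.
- by move=> i /D_law [].
- exact: updates_uniq.
- by move=> v _; exact: measurable_set1_mx.
- by move=> i /D_law /update_law_in_updates.
- exact: A_indep.
- exact: sample_index_uniq.
- by move=> i /mem_sample_index.
- by apply: measurable_continuous_mx; exact: stationary_slope_continuous.
- move=> i /mem_sample_index iD.
  rewrite /mass (update_law_mean (D_law i iD)).
  rewrite -[RHS](update_mean_eq0 Kstoch mu h (nu i.1) i.1).
  apply: eq_bigr => p _; apply: eq_bigr => q _.
  by rewrite stationary_slope_update.
Qed.

End StationarySlope.

Theorem theorem8p1 (R : realType) (n : nat)
    (U : set 'M[R]_n) (muext : 'M[R]_n -> 'cV[R]_n)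
    (hext : stationary_extension U muext)
    (K : 'M[R]_n) (Kstoch : stochastic K) (Kirr : irreducible_mx K)
    (Kaper : aperiodic_mx K)
    (mu : 'cV[R]_n) (hmu : stationary K mu)
    (f h : 'cV[R]_n) (hh : poisson_solution K mu f h)
    (B : {set {set 'I_n}}) (hB : finset.partition B [set: 'I_n]%SET)
    (lambda : {set 'I_n} -> R)
    (lambda_gt0 : forall u, u \in B -> 0 < lambda u)
    (lambda_sum : \sum_(u in B) lambda u = 1)
    (nu : {set 'I_n} -> 'cV[R]_n)
    (nu_ge0 : forall u, u \in B -> forall p, 0 <= nu u p 0)
    (nu_supp : forall u, u \in B -> forall p, p \notin u -> nu u p 0 = 0)
    (nu_sum : forall u, u \in B -> \sum_(p in u) nu u p 0 = 1)
    (d : measure_display) (T : measurableType d) (P : probability T R)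
    (A : {set 'I_n} -> nat -> T -> borel_mx R n)
    (A_law : forall u k, u \in B -> (0 < k)%N ->
       has_update_law P K u (nu u) (A u k))
    (A_indep : independent_on P
       [set i : {set 'I_n} * nat | (i.1 \in B) && (0 < i.2)%N]
       (fun i => A i.1 i.2)) :
  (fun N : nat =>
     'E_P[fun w : T =>
       (derive1 (fun eps : R =>
          dotv (muext (K + eps *: Bmx B lambda A N w)) f) 0 ^+ 2)%R])%E @ \oo -->
  (\sum_(u in B) (lambda u)^-1 *
     \sum_(p in u) nu u p 0 * mu p 0 ^+ 2 *
       ((K *m sqv h) p 0 - (K *m h) p 0 ^+ 2))%:E.
Proof.
under eq_fun do
  rewrite (second_moment_derivative hext Kstoch Kirr hmu hh lambda A_law A_indep).
apply: cvg_EFin; first by near=> N.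
apply: cvg_big => [|u uB]; first exact: add_continuous.
by apply: cvgM (cvg_cst _); apply: cvg_div_truncn; exact: lambda_gt0.
Unshelve. all: by end_near. Qed.
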